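(* Let $G$ be a finite group whose irreducible complex representations have dimensions $n_\ell$, and let $M=(V,E,F)$ be a map. Then (i) the number of nowhere-identity local $G$-flows of $M$ is $$q_G(M)=\sum_{A\subseteq E}(-1)^{|A^c|}|G|^{n(M\backslash A^c)}\prod_{\text{components }M_j\text{ of }M\backslash A^c}\left(\frac{1}{|G|}\sum_\ell n_\ell^{\chi(M_j)}\right);$$ (ii) the number of nowhere-identity local $G$-tensions of $M$ is $$p_G(M)=\sum_{A\subseteq E}(-1)^{|A|}|G|^{n^*(M/A)}\prod_{\text{components }M_i\text{ of }M/A}\left(\frac{1}{|G|}\sum_\ell n_\ell^{\chi(M_i)}\right),$$ where $A^c=E\setminus A$ and $\chi(N)=2-2g(N)$ for a connected map $N$.
   Context: A connected map is a 2-cell embedding of a finite connected graph (loops and multiple edges allowed) in a closed connected oriented surface (equivalently a connected graph with a rotation system). A map is a finite disjoint union of connected maps, each in its own surface. For a map $M$: $v(M),e(M),k(M)$ are the numbers of vertices, edges, components; $f(M)$ total number of faces; $g(M)$ sum of genera of components; $n(M)=e(M)-v(M)+k(M)$, $n^*(M)=e(M)-f(M)+k(M)$. Deletion $M\backslash e$ removes $e$ from the rotation system (same vertex set; resulting components regarded as their own maps); contraction is $M/e=(M^*\backslash e^* )^*$ with $M^*$ the componentwise surface dual. Fix an arbitrary orientation of the edges. A nowhere-identity local $G$-flow is an assignment of non-identity elements of $G$ to edges such that at each vertex the product of the values over the incident edge-ends in anticlockwise rotation order, inverted at ends where the edge is incoming, is the identity (a loop contributes twice, once outgoing and once incoming).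 A nowhere-identity local $G$-tension is an assignment of non-identity elements of $G$ to edges such that around each face the product of the values in anticlockwise cyclic order of traversal, inverted on edges traversed backwards, is the identity. These counts are independent of the orientation. *)

(* Defs.v *)
From HB Require Import structures.
From mathcomp Require Import all_boot all_order all_algebra all_fingroup.
From mathcomp Require Import all_field all_character.

Set Implicit Arguments.
Unset Strict Implicit.
Unset Printing Implicit Defensive.

Import GRing.Theory.

(* A finite, not necessarily connected, map with oriented edges, given by its
   rotation system.  The ends of an edge e are the darts (e, false), its tail,
   where e is outgoing, and (e, true), its head, where e is incoming; since any
   end of an edge may be the one labelled false, a [cmap] is a map together
   with an arbitrary orientation of its edges.  [vrot] sends a dart to the next
   one in anticlockwise order around its vertex, so its cycles are the vertices
   of positive degree.  [isov] is the set of the vertices of degree 0; each of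
   them is a component of its own, embedded in a sphere, with one face. *)
Record cmap : Type := Cmap {
  edge : finType;
  vrot : {perm edge * bool};
  isov : finType
}.

Definition dart (M : cmap) : finType := (edge M * bool)%type.

Definition flip_fun (M : cmap) (d : dart M) : dart M := (d.1, ~~ d.2).

Lemma flip_funK (M : cmap) : involutive (@flip_fun M).
Proof. by case=> e b; rewrite /flip_fun /= negbK. Qed.

Definition dflip (M : cmap) : {perm dart M} := perm (inv_inj (@flip_funK M)).

(* A dart also stands for the traversal of its edge away from that end.  Walking
   around a face anticlockwise, i.e. with the face on the left, one arrives at
   the opposite end and leaves along the preceding dart in anticlockwise order
   around that vertex: frot d = (vrot M)^-1 (dflip M d). *)
Definition frot (M : cmap) : {perm dart M} := (dflip M * (vrot M)^-1)%g.

(* The dual edge of e leaves the face to the left of e; around the vertex dual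
   to a face, the darts follow each other as around the face.  With this choice
   the double dual is M with all edges reversed. *)
Definition dual_map (M : cmap) : cmap :=
  {| edge := edge M; vrot := frot M; isov := isov M |}.

Section Deletion.

Variables (M : cmap) (B : {set edge M}).

Definition kept_edge : finType := {e : edge M | e \notin B}.

Definition kept_dart (d : kept_edge * bool) : dart M := (val d.1, d.2).

Definition to_kept (d : dart M) : option (kept_edge * bool) :=
  omap (fun e => (e, d.2)) (insub d.1).

(* The first kept dart met after d when turning around its vertex. *)
Definition next_kept (d : kept_edge * bool) : kept_edge * bool :=
  head d (pmap to_kept (fingraph.orbit (vrot M) (vrot M (kept_dart d)))).

Lemma kept_dart_inj : injective kept_dart.
Proof. by case=> e b [e' b'] [] /val_inj -> ->. Qed.

Lemma to_keptK : ocancel to_kept kept_dart.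
Proof. by case=> e b; rewrite /to_kept /=; case: insubP => //= u _ <-. Qed.

Lemma kept_dartK : pcancel kept_dart to_kept.
Proof. by case=> e b; rewrite /to_kept /kept_dart /= valK. Qed.

Lemma next_keptE (d : kept_edge * bool) :
  exists2 n : nat, kept_dart (next_kept d) = iter n.+1 (vrot M) (kept_dart d) &
    forall m : nat, m < n -> to_kept (iter m.+1 (vrot M) (kept_dart d)) = None.
Proof.
have head_pmap (x : dart M) k :
  (exists2 n, to_kept (iter n (vrot M) x) = Some (head d (pmap to_kept (traject (vrot M) x k))) &
     forall m, m < n -> to_kept (iter m (vrot M) x) = None)
  \/ (forall m, m < k -> to_kept (iter m (vrot M) x) = None).
  elim: k x => [|k IHk] x; first by right.
  rewrite trajectS /=; case Dx: (to_kept x) => [y|] /=; first by left; exists 0.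
  case: (IHk (vrot M x)) => [[n Dn lt_n]|nok]; [left; exists n.+1|right].
  - by rewrite iterSr.
  - by case=> // m lt_mn; rewrite iterSr lt_n.
  - by case=> // m lt_mn; rewrite iterSr nok.
rewrite /next_kept /fingraph.orbit; set x := vrot M _; set k := fingraph.order _ _.
case: (head_pmap x k) => [[n Dn lt_n]|nok].
  exists n; last by move=> m /lt_n; rewrite iterSr.
  by rewrite iterSr; have := to_keptK (iter n (vrot M) x); rewrite Dn.
have Cxd : fconnect (vrot M) x (kept_dart d).
  by rewrite fconnect_sym ?fconnect1 //; apply: perm_inj.
have := nok _ (findex_max Cxd).
by rewrite iter_findex // kept_dartK.
Qed.

Lemma next_kept_inj : injective next_kept.
Proof.
have wl d1 d2 n1 n2 : n1 <= n2 ->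
    iter n1.+1 (vrot M) (kept_dart d1) = iter n2.+1 (vrot M) (kept_dart d2) ->
    (forall m, m < n2 -> to_kept (iter m.+1 (vrot M) (kept_dart d2)) = None) ->
  d1 = d2.
  move=> le_n; rewrite -(subnKC le_n) -addSn iterD => eq_it nok.
  have iter_inj k : injective (iter k (vrot M)).
    by elim: k => [|k IHk] x y //= /perm_inj /IHk.
  move/iter_inj: eq_it; case Dk: (n2 - n1) => [|k] /= Dd.
    exact: kept_dart_inj.
  have lt_k : k < n1 + (n2 - n1) by rewrite Dk addnS ltnS leq_addl.
  by have := nok k lt_k; rewrite /= -Dd kept_dartK.
move=> d1 d2; have [n1 Dn1 ok1] := next_keptE d1.
have [n2 Dn2 ok2] := next_keptE d2 => /(congr1 kept_dart).
rewrite Dn1 Dn2 => eq_it.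
case/orP: (leq_total n1 n2) => le_n; first exact: wl le_n eq_it ok2.
by apply/esym; apply: wl le_n (esym eq_it) ok1.
Qed.

(* Deletion keeps the vertex set: the vertices all of whose edges are deleted
   become isolated. *)
Definition delete_edges : cmap :=
  {| edge := kept_edge;
     vrot := perm next_kept_inj;
     isov := (isov M +
       {p : {set dart M} | (p \in porbits (vrot M)) &&
                           [forall d in p, d.1 \in B]})%type |}.

End Deletion.

Definition contract_edges (M : cmap) (A : {set edge M}) : cmap :=
  dual_map (delete_edges (M := dual_map M) A).

Section Invariants.

Variable M : cmap.

Definition nb_vert : nat := #|porbits (vrot M)| + #|isov M|.
Definition nb_edge : nat := #|edge M|.
Definition nb_face : nat := #|porbits (frot M)| + #|isov M|.

Definition dart_comps : {set {set dart M}} :=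
  [set action.orbit 'P <<[set vrot M; dflip M]>>%g d | d : dart M].

Definition component : finType :=
  ({c : {set dart M} | c \in dart_comps} + isov M)%type.

Definition nb_comp : nat := #|component|.

Definition comp_vert (c : component) : nat :=
  match c with
  | inl o => #|[set p in porbits (vrot M) | p \subset val o]|
  | inr _ => 1
  end.

Definition comp_edge (c : component) : nat :=
  match c with
  | inl o => #|[set e : edge M | ((e, false) : dart M) \in val o]|
  | inr _ => 0
  end.

Definition comp_face (c : component) : nat :=
  match c with
  | inl o => #|[set p in porbits (frot M) | p \subset val o]|
  | inr _ => 1
  end.

Local Open Scope ring_scope.

(* The genus of the surface of a component is defined by Euler's formula
   v - e + f = 2 - 2 g; the division by 2 is exact. *)
Definition genus (c : component) : int :=
  ((2 - ((comp_vert c)%:Z - (comp_edge c)%:Z + (comp_face c)%:Z)) %/ 2)%Z.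

Definition chi (c : component) : int := 2 - 2 * genus c.

Definition nullity : int := nb_edge%:Z - nb_vert%:Z + nb_comp%:Z.

Definition dual_nullity : int := nb_edge%:Z - nb_face%:Z + nb_comp%:Z.

End Invariants.

Section FlowsTensions.

Variables (gT : finGroupType) (G : {group gT}) (M : cmap).

Implicit Type x : {ffun edge M -> gT}.

Local Open Scope group_scope.

Definition dart_val x (d : dart M) : gT := if d.2 then (x d.1)^-1 else x d.1.

Definition nowhere_id x : bool := [forall e, (x e \in G) && (x e != 1)].

(* That a product in cyclic order is 1 does not depend on the dart it starts
   from; isolated vertices only contribute empty products. *)
Definition local_flow x : bool :=
  [forall d, \prod_(d' <- fingraph.orbit (vrot M) d) dart_val x d' == 1].

Definition local_tension x : bool :=
  [forall d, \prod_(d' <- fingraph.orbit (frot M) d) dart_val x d' == 1].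

Definition flow_count : nat := #|[set x | nowhere_id x && local_flow x]|.

Definition tension_count : nat := #|[set x | nowhere_id x && local_tension x]|.

(* The dimension of the irreducible representation 'Chi_i; the representations
   are over algC, and algebraic and complex numbers give the same dimensions. *)
Definition irr_dim (i : Iirr G) : nat := irr_degree (socle_of_Iirr i).

Definition comp_factor (N : cmap) (c : component N) : algC :=
  ((#|G|%:R)^-1 * \sum_(i : Iirr G) (irr_dim i)%:R ^ chi c)%R.

End FlowsTensions.

(* Main.v *)
Require Import Defs.
From mathcomp Require Import all_boot all_order all_algebra all_fingroup.
From mathcomp Require Import all_field all_character.
From mathcomp Require Import zify ring.

Set Implicit Arguments.
Unset Strict Implicit.
Unset Printing Implicit Defensive.

Import GRing.Theory Num.Theory.

Local Open Scope ring_scope.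

(* By column orthogonality, the indicator of g = 1 in G is the sum over the
   irreducible representations rho_l of (n_l / |G|) tr rho_l(g).  Apply this to
   the product around each vertex and expand the traces: the number of local
   flows, identity values allowed, is a sum over the assignments of a
   representation and a matrix index to each dart.  By Schur orthogonality, the
   sum over the value of an edge e vanishes unless the representations at the
   ends of e agree and the indices match along its two sides, and is then
   |G| / n_l.  So each component carries a single representation l, each face a
   single index, and a component with v vertices, e edges and f faces
   contributes the sum over l of (n_l / |G|)^(v - e) n_l^f.
   Inclusion-exclusion on the edges with identity value gives (i), since flows
   trivial on B are flows of the map with B deleted, and duality gives (ii). *)

(** * Schur orthogonality *)

Section Schur.

Variables (gT : finGroupType) (G : {group gT}).

(** The intertwining relation extends linearly from G to the group algebra, where the Wedderburn
    identities separate the irreducible representations. *)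
Lemma gring_op_intertwine n1 n2 (r1 : mx_representation algC G n1)
    (r2 : mx_representation algC G n2) (f : 'M_(n1, n2)) A :
  {in G, forall x, r1 x *m f = f *m r2 x} ->
  gring_op r1 A *m f = f *m gring_op r2 A.
Proof.
move=> hom_f; rewrite !gring_opE /gring_mx /= !mulmx_sum_row !linear_sum /=.
rewrite mulmx_suml; apply: eq_bigr => i _.
by rewrite !linearZ /= !rowK !mxvecK -scalemxAl hom_f ?enum_valP.
Qed.

(** Replacing g by x^-1 g in the sum moves the factor at x from the left side to the right. *)
Lemma average_intertwine n1 n2 (r1 : mx_representation algC G n1)
    (r2 : mx_representation algC G n2) (B : 'M_(n1, n2)) :
  {in G, forall x, r1 x *m (\sum_(g in G) r1 g *m B *m r2 g^-1%g) =
                   (\sum_(g in G) r1 g *m B *m r2 g^-1%g) *m r2 x}.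
Proof.
move=> x Gx; rewrite mulmx_sumr mulmx_suml (reindex_inj (mulgI x^-1)%g) /=.
apply: eq_big => [g|g Gg]; first by rewrite groupMl ?groupV.
have Gg': g \in G by rewrite -(groupMl _ (groupVr Gx)).
rewrite invMg invgK -!mulmxA -repr_mxM ?groupV // mulmxA -repr_mxM //.
by rewrite mulKVg !repr_mxM ?groupV // !mulmxA.
Qed.

Lemma sum_repr_delta n1 n2 (r1 : mx_representation algC G n1)
    (r2 : mx_representation algC G n2) a b c d :
  \sum_(g in G) r1 g a b * r2 g^-1%g c d =
  (\sum_(g in G) r1 g *m delta_mx b c *m r2 g^-1%g) a d.
Proof.
rewrite summxE; apply: eq_bigr => g _.
rewrite -(mul_delta_mx (0 : 'I_1)) mulmxA -colE -mulmxA -rowE.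
by rewrite mxE big_ord1 !mxE.
Qed.

(** The averaged matrix unit intertwines the two representations. The Wedderburn identity of j acts
    as 1 on the right and as 0 on the left, so this matrix is 0. *)
Lemma schur_neq (i j : Iirr G) a b c d :
  i != j -> \sum_(g in G) 'Chi_i g a b * 'Chi_j g^-1%g c d = 0.
Proof.
move=> ne_ij; rewrite sum_repr_delta.
have := gring_op_intertwine (Wedderburn_id (socle_of_Iirr j))
  (average_intertwine 'Chi_i 'Chi_j (delta_mx b c)).
rewrite op_Wedderburn_id_pchar ?algC'G_pchar // mulmx1 => <-.
rewrite (irr_repr'_op0_pchar _ _ (Wedderburn_id_mem _)) ?algC'G_pchar //.
  by rewrite mul0mx mxE.
by rewrite eq_sym (can_eq socle_of_IirrK).
Qed.

(** The averaged matrix unit commutes with an absolutely irreducible representation, hence is a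
    scalar; the scalar is read off the trace, computed by cyclicity. *)
Lemma schur_eq (i : Iirr G) a b c d :
  \sum_(g in G) 'Chi_i g a b * 'Chi_i g^-1%g c d =
  #|G|%:R / (irr_dim i)%:R * ((a == d) && (b == c))%:R.
Proof.
have nz : (irr_dim i)%:R != 0 :> algC by rewrite pnatr_eq0 -lt0n irr_degree_gt0.
rewrite sum_repr_delta; set T := \sum_(g in G) _.
have /is_scalar_mxP[l defT]: is_scalar_mx T.
  apply: mx_abs_irr_cent_scalar ('Chi_i) _ _ _; first exact/groupC/socle_irr.
  by apply/centgmxP => x Gx; rewrite average_intertwine.
have : \tr T = #|G|%:R * (b == c)%:R.
  transitivity (\sum_(g in G) \tr ('Chi_i g *m delta_mx b c *m 'Chi_i g^-1%g)).
    exact: raddf_sum.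
  rewrite (eq_bigr (fun=> (b == c)%:R)) => [|g Gg].
    by rewrite sumr_const mulr_natl.
  rewrite mxtrace_mulC mulmxA -repr_mxM ?groupV // mulVg repr_mx1 mul1mx.
  rewrite -(mul_delta_mx (0 : 'I_1)) mxtrace_mulC.
  by rewrite -rowE trace_mx11 !mxE andbT eq_sym.
rewrite defT mxtrace_scalar -[LHS]mulr_natr => tr_l.
rewrite -[l](mulfK nz) tr_l mxE -mulnb natrM.
case: (a == d); rewrite ?mulr0n ?mul0r ?mulr0 //.
by rewrite mulr1n mul1r mulrAC.
Qed.

(** Basis indices of the direct sum of all irreducible representations: one such index is the state
    of a dart. *)
Definition irr_index : finType := {i : Iirr G & 'I_(irr_dim i)}.

(* The block diagonal sum of all the irreducible representations. *)
Definition irr_entry (g : gT) (k l : irr_index) : algC :=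
  if tag k == tag l then 'Chi_(tag k) g (tagged k) (tagged_as k l) else 0.

Definition Iirr_weight (i : Iirr G) : algC := (irr_dim i)%:R / #|G|%:R.

Definition irr_weight (k : irr_index) : algC := Iirr_weight (tag k).

Lemma irr_entry_tag i (a b : 'I_(irr_dim i)) g :
  irr_entry g (Tagged (fun i => 'I_(irr_dim i)) a)
              (Tagged (fun i => 'I_(irr_dim i)) b) = 'Chi_i g a b.
Proof. by rewrite /irr_entry /= eqxx tagged_asE. Qed.

Lemma irr_entry_neq g (k l : irr_index) :
  tag k != tag l -> irr_entry g k l = 0.
Proof. by rewrite /irr_entry => /negPf->. Qed.

Lemma irr_entry1 k l : irr_entry 1%g k l = (k == l)%:R.
Proof.
have [eq_kl|ne_kl] := eqVneq (tag k) (tag l); last first.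
  rewrite irr_entry_neq //; case: (eqVneq k l) => // eq_kl.
  by rewrite eq_kl eqxx in ne_kl.
case: k l eq_kl => [i a] [j b] /= eq_ij; case: _ / eq_ij b => b.
by rewrite irr_entry_tag repr_mx1 mxE -tag_eqE /tag_eq /= eqxx tagged_asE.
Qed.

Lemma sum_irr_index (F : irr_index -> algC) :
  \sum_k F k =
  \sum_i \sum_(a < irr_dim i) F (Tagged (fun i => 'I_(irr_dim i)) a).
Proof. by rewrite sig_big_dep /=; apply: eq_bigr => -[]. Qed.

Lemma irr_entryM g h k l : g \in G -> h \in G ->
  irr_entry (g * h)%g k l = \sum_m irr_entry g k m * irr_entry h m l.
Proof.
move=> Gg Gh; rewrite sum_irr_index (bigD1 (tag k)) //= [X in _ + X]big1.
  rewrite addr0; case: k => i a /=.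
  have [eq_ij|ne_ij] := eqVneq i (tag l); last first.
    rewrite irr_entry_neq // big1 // => b _.
    by rewrite mulrC irr_entry_neq ?mul0r.
  case: l eq_ij => j b /= eq_ij; case: _ / eq_ij b => b.
  rewrite irr_entry_tag repr_mxM // mxE.
  by apply: eq_bigr => c _; rewrite !irr_entry_tag.
by move=> j ne_ji; rewrite big1 // => b _; rewrite irr_entry_neq ?mul0r // eq_sym.
Qed.

(** Decomposition of the regular character, which is |G| at 1 and 0 elsewhere. *)
Lemma irr_delta g : g \in G ->
  (g == 1%g)%:R = \sum_k irr_weight k * irr_entry g k k.
Proof.
move=> Gg; have nzG : #|G|%:R != 0 :> algC by rewrite pnatr_eq0 -lt0n cardG_gt0.
apply: (mulIf nzG); rewrite mulr_natl -cfRegE cfReg_sum sum_cfunE.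
rewrite sum_irr_index mulr_suml; apply: eq_bigr => i _.
rewrite cfunE -irrRepr cfRepr1 cfunE Gg mulr1n /mxtrace mulr_suml mulr_sumr.
apply: eq_bigr => a _.
by rewrite irr_entry_tag /irr_weight /Iirr_weight /= mulrAC divfK.
Qed.

(** Both orthogonality relations at once. Equality of the tags of m and n is implied by the three
    conditions listed. *)
Lemma irr_schur (k l m n : irr_index) :
  \sum_(g in G) irr_entry g k l * irr_entry g^-1%g m n =
  [&& tag k == tag l, k == n & l == m]%:R / irr_weight k.
Proof.
have [eq_kl|ne_kl] := eqVneq (tag k) (tag l); last first.
  by rewrite mul0r big1 // => g _; rewrite irr_entry_neq ?mul0r.
have [eq_mn|ne_mn] := eqVneq (tag m) (tag n); last first.
  rewrite big1 => [|g _]; last by rewrite [_ m n]irr_entry_neq ?mulr0.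
  case: and3P => [[_ /eqP eq_kn /eqP eq_lm]|]; last by rewrite mul0r.
  by rewrite -eq_kn -eq_lm eq_kl eqxx in ne_mn.
case: k l eq_kl => [i a] [j b] /= eq_kl; case: _ / eq_kl b => b.
case: m n eq_mn => [j' c] [j'' d] /= eq_mn; case: _ / eq_mn d => d.
under eq_bigr do rewrite !irr_entry_tag.
have [eq_ij|ne_ij] := eqVneq i j'; last first.
  rewrite schur_neq //; case: andP; last by rewrite mul0r.
  by case=> /eqP[eq_ij]; case/eqP: ne_ij.
case: _ / eq_ij c d => c d; rewrite schur_eq mulrC.
rewrite /irr_weight /Iirr_weight /= invf_div.
by rewrite -!tag_eqE /tag_eq /= eqxx !tagged_asE.
Qed.

End Schur.

(** * Traces of products along orbits *)

Section Sections.

Variables (R : comNzRingType) (D I T : finType) (c : D -> T) (s : T -> D).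
Hypothesis scK : cancel s c.

(** Functions constant on the fibres of c are the functions on T composed with c; then
    distributivity applies. *)
Lemma sum_fiberwise_constant (H : T -> I -> R) :
  \sum_(b : {ffun D -> I} | [forall d, b (s (c d)) == b d])
     \prod_t H t (b (s t)) = \prod_t \sum_k H t k.
Proof.
rewrite bigA_distr_bigA /=.
pose h (f : {ffun T -> I}) := [ffun d => f (c d)].
rewrite (reindex_onto h (fun b : {ffun D -> I} => [ffun t => b (s t)])) /=.
  apply: eq_big => [f|f _]; last by apply: eq_bigr => t _; rewrite ffunE scK.
  apply/andP; split; first by apply/forallP=> d; rewrite !ffunE scK.
  by apply/eqP/ffunP=> t; rewrite !ffunE scK.
by move=> b /forallP inv_b; apply/ffunP=> d; rewrite !ffunE; apply/eqP.
Qed.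

End Sections.

Section Traces.

Variables (R : comNzRingType) (D I : finType).

(** The (k, l) entry of the product of the matrices [m d] along p. *)
Fixpoint kernel_prod (m : D -> I -> I -> R) (p : seq D) (k l : I) : R :=
  if p is d :: p' then \sum_j m d k j * kernel_prod m p' j l else (k == l)%:R.

(** Pins b outside p, so that a sum over such b is a sum over the values on p alone. *)
Definition agree_off (p : {pred D}) (a b : {ffun D -> I}) :=
  [forall d, (d \notin p) ==> (b d == a d)].

Lemma agree_offP (p : {pred D}) (a b : {ffun D -> I}) :
  reflect (forall d, d \notin p -> b d = a d) (agree_off p a b).
Proof.
apply: (iffP forallP) => [H d /(implyP (H d)) /eqP // | H d].
by apply/implyP=> /H ->.
Qed.

Definition ffun_upd (a : {ffun D -> I}) (x : D) (k : I) : {ffun D -> I} :=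
  [ffun d => if d == x then k else a d].

Lemma sum_agree_off_cons (x : D) (p : seq D) a (F : {ffun D -> I} -> R) :
    x \notin p ->
  \sum_(b | agree_off (mem (x :: p)) a b) F b =
  \sum_k \sum_(b | agree_off (mem p) (ffun_upd a x k) b) F b.
Proof.
move=> p'x; rewrite (partition_big (fun b : {ffun D -> I} => b x) predT) //=.
apply: eq_bigr => k _; apply: eq_bigl => b.
apply/andP/agree_offP=> [[/agree_offP ab /eqP bx] d p'd | ab].
  rewrite ffunE; case: eqP => [-> // | /eqP ne_dx].
  by apply: ab; rewrite inE negb_or ne_dx.
split; last by rewrite ab // ffunE eqxx.
apply/agree_offP=> d; rewrite inE negb_or => /andP[ne_dx p'd].
by rewrite ab // ffunE (negPf ne_dx).
Qed.

Variables (s : {perm D}) (m : D -> I -> I -> R) (w : I -> R).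

(** The indices on p are the inner indices of a matrix product. The last hypothesis keeps the final
    index fixed, while still allowing the path to close up at x. *)
Lemma sum_path (x : D) (p : seq D) (a : {ffun D -> I}) :
    fpath s x p -> uniq (x :: p) -> s (last x p) \notin p ->
  \sum_(b | agree_off (mem p) a b) \prod_(d <- x :: p) m d (b d) (b (s d)) =
  kernel_prod m (x :: p) (a x) (a (s (last x p))).
Proof.
elim: p x a => [|y p IHp] x a.
  move=> _ _ _; rewrite (big_pred1 a) => [|b]; last first.
    apply/agree_offP/eqP=> [ab|-> //]; by apply/ffunP=> d; apply: ab.
  rewrite big_seq1 /= (bigD1 (a (s x))) //= eqxx mulr1 big1 ?addr0 // => k.
  by move=> /negPf->; rewrite mulr0.
rewrite [last _ _]/= [fpath _ _ _]/=; set z := s (last y p).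
case/andP=> /eqP sx s_p /andP[]; rewrite inE negb_or => /andP[ne_xy p'x] Uyp.
rewrite inE negb_or => /andP[ne_zy p'z].
have [p'y Up] := andP Uyp; rewrite sum_agree_off_cons // [RHS]/=.
apply: eq_bigr => k _.
have := IHp y (ffun_upd a y k) s_p Uyp p'z; rewrite !ffunE eqxx (negPf ne_zy).
rewrite -/z /= => <-; rewrite mulr_sumr; apply: eq_bigr => b /agree_offP ab.
rewrite big_cons; congr (m x _ _ * _); last by rewrite sx ab // ffunE eqxx.
by rewrite ab // ffunE (negPf ne_xy).
Qed.

(** On a whole orbit the path closes up at x, so its two outer indices coincide and summing over
    them gives a weighted trace. *)
Lemma sum_orbit (x : D) (a : {ffun D -> I}) :
  \sum_(b | agree_off (mem (fingraph.orbit s x)) a b)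
     w (b x) * \prod_(d <- fingraph.orbit s x) m d (b d) (b (s d)) =
  \sum_k w k * kernel_prod m (fingraph.orbit s x) k k.
Proof.
have := orbit_uniq s x; have := cycle_orbit (@perm_inj _ s) x.
rewrite /fingraph.orbit -orderSpred trajectS; set p := traject _ _ _ => /= s_p Up.
move: s_p; rewrite rcons_path => /andP[s_p /eqP sz].
have [p'x _] := andP Up; rewrite sum_agree_off_cons //; apply: eq_bigr => k _.
have := @sum_path x p (ffun_upd a x k) s_p Up.
rewrite sz !ffunE eqxx /= => <- //; rewrite mulr_sumr.
by apply: eq_bigr => b /agree_offP ab; rewrite ab // ffunE eqxx.
Qed.

Variables (T : finType) (c : D -> T) (r : T -> D).
Hypothesis c_orbit : forall d t, (d \in fingraph.orbit s (r t)) = (c d == t).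
Variable k0 : I.

Lemma prod_orbit_trace :
  \prod_t \sum_k w k * kernel_prod m (fingraph.orbit s (r t)) k k =
  \sum_(b : {ffun D -> I}) (\prod_t w (b (r t))) * \prod_d m d (b d) (b (s d)).
Proof.
under eq_bigr do rewrite -(sum_orbit _ [ffun=> k0]).
have c_r t : c (r t) = t by apply/eqP; rewrite -c_orbit -fconnect_orbit.
have c_s d : c (s d) = c d.
  apply/eqP; rewrite -c_orbit -fconnect_orbit -same_fconnect1_r //; last first.
    exact: perm_inj.
  by rewrite fconnect_orbit c_orbit.
rewrite (bigA_distr_big_dep
  (fun t => agree_off (mem (fingraph.orbit s (r t))) [ffun=> k0])) /=.
(* Cuts an assignment into one piece per orbit, padded with [k0] off that orbit; these are exactly
   the families produced by distributivity. *)
pose h (a : {ffun D -> I}) : {ffun T -> {ffun D -> I}} :=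
  [ffun t => [ffun d => if c d == t then a d else k0]].
rewrite (reindex_onto h (fun f : {ffun T -> {ffun D -> I}} =>
  [ffun d => f (c d) d])) /=.
  apply: eq_big => [b|b _].
    apply/andP; split; last by apply/eqP/ffunP=> d; rewrite !ffunE eqxx.
    apply/familyP=> t; apply/agree_offP=> d; rewrite [_ \in _]c_orbit !ffunE.
    by move/negPf->.
  rewrite big_split /=; congr (_ * _).
    by apply: eq_bigr => t _; rewrite !ffunE c_r eqxx.
  rewrite [RHS](partition_big c predT) //=; apply: eq_bigr => t _.
  rewrite big_uniq ?orbit_uniq //=; apply: eq_big => [d|d].
    exact: c_orbit.
  by rewrite c_orbit !ffunE c_s => ->.
move=> f /familyP f_fam; apply/ffunP=> t; apply/ffunP=> d; rewrite !ffunE.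
case: eqP => [-> // | /eqP ne_ct]; apply/esym.
by have /agree_offP-> := f_fam t; rewrite ?ffunE // [_ \in _]c_orbit.
Qed.

End Traces.

(** * Components and the parity of the Euler characteristic *)

Section OrbitTypes.

Variables (D : finType) (s : {perm D}).

Definition orbit_type : finType := {p : {set D} | p \in porbits s}.

Definition orbit_of (d : D) : orbit_type := Sub (porbit s d) (imset_f _ isT).

Lemma orbit_of_surj (t : orbit_type) : exists d, orbit_of d == t.
Proof.
case: t => p Ep; case/imsetP: (Ep) => d _ eq_p; exists d.
by rewrite -val_eqE /= eq_p.
Qed.

Definition orbit_rep (t : orbit_type) : D := xchoose (orbit_of_surj t).

Lemma orbit_repK : cancel orbit_rep orbit_of.
Proof. by move=> t; apply/eqP/(xchooseP (orbit_of_surj t)). Qed.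

Lemma eq_orbit_of d d' : (orbit_of d == orbit_of d') = (d \in porbit s d').
Proof. by rewrite -val_eqE /= eq_porbit_mem. Qed.

Lemma porbit_fconnect d d' : (d' \in porbit s d) = fconnect s d d'.
Proof.
apply/porbitP/idP => [[i ->]|]; first by rewrite permX fconnect_iter.
by move/iter_findex <-; exists (findex s d d'); rewrite permX.
Qed.

Lemma mem_orbit_rep d t :
  (d \in fingraph.orbit s (orbit_rep t)) = (orbit_of d == t).
Proof.
by rewrite -{2}(orbit_repK t) eq_orbit_of porbit_fconnect fconnect_orbit.
Qed.

Lemma orbit_of_perm d : orbit_of (s d) = orbit_of d.
Proof. by apply/eqP; rewrite eq_orbit_of -{1}[s]expg1 mem_porbit. Qed.

Lemma orbit_of_fun (X : Type) (u : D -> X) :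
  (forall d, u (s d) = u d) ->
  forall d d', orbit_of d = orbit_of d' -> u d = u d'.
Proof.
move=> us d d' /eqP; rewrite eq_orbit_of => /porbitP[i ->].
by elim: i => [|i <-]; rewrite ?expg0 ?perm1 // expgSr permM us.
Qed.

Variable o : {set D}.
Hypothesis s_o : s \in ('N(o | 'P))%g.

Lemma porbit_restr_in d : d \in o -> porbit (restr_perm o s) d = porbit s d.
Proof.
move=> o_d; have Eiter i : (restr_perm o s ^+ i)%g d = (s ^+ i)%g d.
  elim: i => [|i IHi]; first by rewrite !expg0.
  rewrite !expgSr !permM IHi restr_permE //.
  have s_i: (s ^+ i)%g \in ('N(o | 'P))%g by rewrite groupX.
  by have := astabs_act d s_i; rewrite /= apermE => ->.
by apply/setP=> d'; apply/porbitP/porbitP=> -[i ->]; exists i; rewrite Eiter.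
Qed.

Lemma porbit_sub_stable d : (porbit s d \subset o) = (d \in o).
Proof.
apply/subsetP/idP => [-> //|o_d d' /porbitP[i ->]]; first exact: porbit_id.
have s_i: (s ^+ i)%g \in ('N(o | 'P))%g by rewrite groupX.
by have := astabs_act d s_i; rewrite /= apermE => ->.
Qed.

(** The signature is the parity of the number of points plus the number of cycles. Outside o the
    restriction fixes every point, so each such point counts twice and cancels. *)
Lemma odd_restr_perm :
  odd_perm (restr_perm o s) =
  odd #|o| (+) odd #|[set p in porbits s | p \subset o]|.
Proof.
rewrite /odd_perm; have -> : porbits (restr_perm o s) =
    [set p in porbits s | p \subset o] :|: set1 @: (~: o).
  apply/setP=> p; rewrite inE [X in _ = X || _]inE; apply/imsetP/orP.
    case=> d _ ->; case: (boolP (d \in o)) => o_d; [left | right].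
      by rewrite porbit_restr_in // porbit_sub_stable o_d andbT imset_f.
    apply/imsetP; exists d; first by rewrite inE.
    apply/setP=> d'; rewrite inE; apply/porbitP/eqP=> [[i ->]|->]; last first.
      by exists 0%N; rewrite expg0 perm1.
    elim: i => [|i IHi]; first by rewrite expg0 perm1.
    by rewrite expgSr permM IHi (out_perm (restr_perm_on _ _)).
  case=> [/andP[/imsetP[d _ ->]]|/imsetP[d]].
    by rewrite porbit_sub_stable => o_d; exists d; rewrite ?porbit_restr_in.
  rewrite inE => o'd ->; exists d => //.
  apply/setP=> d'; rewrite inE; apply/eqP/porbitP=> [->|[i ->]].
    by exists 0%N; rewrite expg0 perm1.
  elim: i => [|i IHi]; first by rewrite expg0 perm1.
  by rewrite expgSr permM IHi (out_perm (restr_perm_on _ _)).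
rewrite cardsU disjoint_setI0 ?cards0 ?subn0; last first.
  rewrite -setI_eq0; apply/eqP/setP=> p; rewrite !inE.
  apply/negP=> /andP[/andP[_ /subsetP o_p] /imsetP[d]]; rewrite inE => o'd Ep.
  by rewrite o_p // Ep inE in o'd.
rewrite card_imset; last exact: set1_inj.
rewrite oddD -(cardsC o) oddD.
by do 3!case: (odd _).
Qed.

End OrbitTypes.

Section Components.

Variable N : cmap.

Local Notation H := <<[set vrot N; dflip N]>>%g.

(** The components with at least one edge; isolated vertices form the other summand of
    [component]. *)
Definition comp_type : finType := {c : {set dart N} | c \in dart_comps N}.

Definition comp_of (d : dart N) : comp_type :=
  Sub (action.orbit 'P H d) (imset_f _ isT).

Lemma comp_of_surj (c : comp_type) : exists d, comp_of d == c.
Proof.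
case: c => o Eo; case/imsetP: (Eo) => d _ eq_o; exists d.
by rewrite -val_eqE /= eq_o.
Qed.

Definition comp_rep (c : comp_type) : dart N := xchoose (comp_of_surj c).

Lemma comp_repK : cancel comp_rep comp_of.
Proof. by move=> c; apply/eqP/(xchooseP (comp_of_surj c)). Qed.

Lemma eq_comp_of d (c : comp_type) : (comp_of d == c) = (d \in val c).
Proof. by rewrite -(comp_repK c) -val_eqE /= orbit_eq_mem. Qed.

Lemma vrot_gen : vrot N \in H.
Proof. by rewrite mem_gen // !inE eqxx. Qed.

Lemma dflip_gen : dflip N \in H.
Proof. by rewrite mem_gen // !inE eqxx orbT. Qed.

Lemma frot_gen : frot N \in H.
Proof. by rewrite groupM ?groupV ?vrot_gen ?dflip_gen. Qed.

Lemma comp_of_gen h d : h \in H -> comp_of (h d) = comp_of d.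
Proof. by move=> Hh; apply/val_inj/orbit_eqP; apply: mem_orbit. Qed.

(** Two darts of one component differ by a word in the generators, so invariance under the
    generators suffices. *)
Lemma comp_of_fun (X : Type) (u : dart N -> X) :
    (forall d, u (vrot N d) = u d) -> (forall d, u (dflip N d) = u d) ->
  forall d d', comp_of d = comp_of d' -> u d = u d'.
Proof.
move=> uv uf d d' /eqP; rewrite eq_comp_of /= => /orbitP[h Hh <-] {d}.
case/gen_prodgP: Hh => n [g gP ->] /=; rewrite apermE.
elim: n g gP d' => [|n IHn] g gP d'; first by rewrite big_ord0 perm1.
rewrite big_ord_recl permM IHn => [|i]; last exact: gP.
by have:= gP ord0; rewrite !inE => /orP[] /eqP->.
Qed.

Lemma gen_stable h (c : comp_type) : h \in H -> h \in ('N(val c | 'P))%g.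
Proof.
move=> Hh; rewrite !inE.
apply/subsetP=> d; rewrite !inE /= apermE -!eq_comp_of.
by rewrite comp_of_gen.
Qed.

(** A cycle of h lies in c as soon as its representative does. Counting along the fibres of a map to
    components allows products to be regrouped by component. *)
Lemma card_comp_orbits h (c : comp_type) : h \in H ->
  #|[set p in porbits h | p \subset val c]| =
  #|[pred t : orbit_type h | comp_of (orbit_rep t) == c]|.
Proof.
move=> Hh; rewrite -(card_imset _ (@val_inj _ _ (orbit_type h))).
apply: eq_card => p; rewrite inE; apply/andP/imsetP => [[Pp s_pc]|[t]].
  have [t Et] : exists t : orbit_type h, p = val t by exists (Sub p Pp).
  exists t => //; rewrite inE eq_comp_of -(porbit_sub_stable (gen_stable c Hh)).
  by rewrite -[porbit h _]/(val (orbit_of h _)) orbit_repK -Et.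
rewrite inE eq_comp_of => t_c ->; split; first exact: valP.
by rewrite -(congr1 val (orbit_repK t)) porbit_sub_stable ?gen_stable.
Qed.

Lemma card_comp_edges (c : comp_type) :
  comp_edge (inl c) = #|[pred e : edge N | comp_of (e, false) == c]|.
Proof. by apply: eq_card => e; rewrite !inE eq_comp_of. Qed.

(** Both ends of an edge lie in the same component. The number being even, it drops out of
    signatures. *)
Lemma card_comp_darts (c : comp_type) : #|val c| = (comp_edge (inl c)).*2.
Proof.
have card_b b :
    #|[set d in val c | d.2 == b]| =
    #|[set e : edge N | ((e, b) : dart N) \in val c]|.
  rewrite -[RHS](card_imset _ (_ : injective (fun e : edge N => (e, b) : dart N))).
    apply: eq_card => -[e b']; rewrite !inE /=; apply/andP/imsetP.
      by case=> c_eb /eqP eq_b; exists e; rewrite ?inE -?eq_b.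
    by case=> e'; rewrite inE => c_eb [-> ->].
  by move=> e e' [].
rewrite -(cardsID [set d : dart N | d.2 == false]) -addnn.
have -> : val c :&: [set d | d.2 == false] = [set d in val c | d.2 == false].
  by apply/setP=> d; rewrite !inE.
have -> : val c :\: [set d | d.2 == false] = [set d in val c | d.2 == true].
  by apply/setP=> -[e []]; rewrite !inE /= ?andbT ?andbF.
rewrite !card_b; congr (_ + _)%N; apply: eq_card => e; rewrite !inE -!eq_comp_of.
by rewrite -(comp_of_gen (e, false) dflip_gen) permE.
Qed.

Lemma card_comp_flips (c : comp_type) :
  #|[set p in porbits (dflip N) | p \subset val c]| = comp_edge (inl c).
Proof.
have inj_p : injective (fun e : edge N => porbit (dflip N) (e, false)).
  move=> e e' /eqP; rewrite eq_porbit_mem => /porbitP[i /(congr1 fst) /= ->].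
  by elim: i => [|i IHi]; rewrite ?expg0 ?perm1 // expgSr permM permE.
rewrite /comp_edge -(card_imset _ inj_p); apply: eq_card => p; rewrite inE.
apply/andP/imsetP => [[/imsetP[[e b] _ ->]] | [e]].
  rewrite porbit_sub_stable ?gen_stable ?dflip_gen // => c_eb; exists e.
    move: c_eb; rewrite inE -!eq_comp_of; case: b => //.
    by rewrite -(comp_of_gen (e, false) dflip_gen) permE.
  case: b c_eb => // _; apply/eqP; rewrite eq_porbit_mem.
  by rewrite -(porbit_perm (dflip N) 1) expg1 permE porbit_id.
rewrite inE => c_e ->; split; first exact: imset_f.
by rewrite porbit_sub_stable ?gen_stable ?dflip_gen.
Qed.

(* The permutation [frot] is the product of [dflip] and the inverse of [vrot];
   compare the signatures of their restrictions to the component. *)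
Lemma odd_euler (c : comp_type) :
  odd (comp_face (inl c)) = odd (comp_edge (inl c)) (+) odd (comp_vert (inl c)).
Proof.
have oddE h : h \in H -> odd_perm (restr_perm (val c) h) =
    odd #|[set p in porbits h | p \subset val c]|.
  by move=> Hh; rewrite odd_restr_perm ?gen_stable // card_comp_darts odd_double.
rewrite -card_comp_flips /comp_face /comp_vert -!oddE
  ?vrot_gen ?dflip_gen ?frot_gen //.
rewrite morphM ?groupV ?gen_stable ?vrot_gen ?dflip_gen // morphV
  ?gen_stable ?vrot_gen //.
by rewrite odd_permM odd_permV.
Qed.

(** By [odd_euler] the integer division in [genus] is exact. *)
Lemma chi_inl (c : comp_type) : chi (inl c : component N) =
  (comp_vert (inl c))%:Z - (comp_edge (inl c))%:Z + (comp_face (inl c))%:Z.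
Proof.
rewrite /chi /genus.
set v := comp_vert _; set e := comp_edge _; set f := comp_face _.
have [k ->] : exists k : int, v%:Z - e%:Z + f%:Z = 2 * k.
  (* Because v - e + f = (v + e + f) - 2 e. *)
  exists ((v + e + f)./2%:Z - e%:Z).
  have ev : odd (v + e + f) = false.
    by rewrite !oddD odd_euler -/v -/e; case: (odd v); case: (odd e).
  have := odd_double_half (v + e + f); rewrite ev add0n; lia.
have -> : 2 - 2 * k = 2 * (1 - k) by lia.
by rewrite mulKz //; lia.
Qed.

Lemma chi_inr (i : isov N) : chi (inr i : component N) = 2.
Proof. by []. Qed.

End Components.

(** * The state sum *)

(** Turns the contribution of a component in the state sum into the form of the theorem, with a the
    dimension of the representation and g the order of the group. *)
Lemma euler_monomial (F : fieldType) (a g : F) (v e f : nat) :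
    a != 0 -> g != 0 ->
  (a / g) ^+ v * (a / g) ^- e * a ^+ f =
  g ^ (e%:Z - v%:Z + 1) * (g^-1 * a ^ (v%:Z - e%:Z + f%:Z)).
Proof.
move=> nza nzg; rewrite !expfzDr // -!invr_expz -!exprnP !expr_div_n.
move: (expf_neq0 v nza) (expf_neq0 e nza) (expf_neq0 v nzg) (expf_neq0 e nzg).
move: (a ^+ v) (a ^+ e) (g ^+ v) (g ^+ e) (a ^+ f) => av ae gv ge af *.
by rewrite expr1; field; do ?[apply/andP; split].
Qed.

Lemma dflipK (N : cmap) : involutive (dflip N).
Proof. by move=> d; rewrite !permE flip_funK. Qed.

(** A rotation conjugates the product. *)
Lemma prod_rot_eq1 (gT : finGroupType) (T : Type) (p : seq T) (i : nat)
    (y : T -> gT) :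
  ((\prod_(d <- rot i p) y d)%g == 1%g) = ((\prod_(d <- p) y d)%g == 1%g).
Proof.
rewrite /rot -{3}(cat_take_drop i p) !big_cat /=.
by rewrite -!eq_invg_mul eq_sym eq_invg_sym.
Qed.

Lemma prod_orbit_eq1 (gT : finGroupType) (T : finType) (s : {perm T})
    (y : T -> gT) d d' :
    d' \in fingraph.orbit s d ->
  ((\prod_(t <- fingraph.orbit s d') y t)%g == 1%g) =
  ((\prod_(t <- fingraph.orbit s d) y t)%g == 1%g).
Proof.
move=> d_d'; have [i ->] := orbit_rot_cycle (cycle_orbit (@perm_inj _ s) d)
  (orbit_uniq s d) d_d'.
exact: prod_rot_eq1.
Qed.

Section FlowSum.

Variables (gT : finGroupType) (G : {group gT}) (N : cmap).

Local Notation I := (irr_index G).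
Local Notation D := (dart N).
Local Notation word x d :=
  (\prod_(d' <- fingraph.orbit (vrot N) d) dart_val x d')%g.

Lemma local_flowE (x : {ffun edge N -> gT}) :
  local_flow x = [forall t, word x (orbit_rep (s := vrot N) t) == 1%g].
Proof.
apply/forallP/forallP => flow_x d; first exact: flow_x.
have r_d : d \in fingraph.orbit (vrot N) (orbit_rep (orbit_of (vrot N) d)).
  by rewrite mem_orbit_rep.
by rewrite (prod_orbit_eq1 _ r_d) (eqP (flow_x _)).
Qed.

Lemma kernel_prod_irr_entry (T : finType) (y : T -> gT) (p : seq T) (k l : I) :
    (forall d, y d \in G) ->
  kernel_prod (fun d => @irr_entry gT G (y d)) p k l =
  irr_entry (\prod_(d <- p) y d)%g k l.
Proof.
move=> Gy; elim: p k l => [|d p IHp] k l /=; first by rewrite big_nil irr_entry1.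
rewrite big_cons irr_entryM ?Gy //; last by apply: group_prod.
by apply: eq_bigr => j _; rewrite IHp.
Qed.

Lemma dart_val_in (x : {ffun edge N -> gT}) d :
  (forall e, x e \in G) -> dart_val x d \in G.
Proof. by move=> Gx; rewrite /dart_val; case: d.2; rewrite ?groupV. Qed.

(** An arbitrary default index, taken in the trivial representation. *)
Definition irr0_index : I :=
  Tagged (fun i => 'I_(irr_dim i))
    (Ordinal (irr_degree_gt0 (socle_of_Iirr (0 : Iirr G)))).

(** [irr_delta] turns the condition at each vertex into a weighted trace; all traces are then
    expanded at once over the states of the darts. *)
Lemma flow_indicator (x : {ffun edge N -> gT}) : (forall e, x e \in G) ->
  (local_flow x)%:R = \sum_(b : {ffun D -> I})
    (\prod_t irr_weight (b (orbit_rep (s := vrot N) t))) *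
    \prod_d irr_entry (dart_val x d) (b d) (b (vrot N d)) :> algC.
Proof.
move=> Gx.
rewrite -(prod_orbit_trace (fun d => @irr_entry gT G (dart_val x d))
  (@irr_weight gT G) (@mem_orbit_rep _ (vrot N)) irr0_index).
under eq_bigr => t _.
  under eq_bigr => k _.
    rewrite kernel_prod_irr_entry; last by move=> d; apply: dart_val_in.
    over.
  rewrite -irr_delta; last by apply: group_prod => d _; apply: dart_val_in.
  over.
rewrite local_flowE; case: forallP => [flow_x | nflow_x].
  by rewrite big1 // => t _; rewrite flow_x.
have /forallPn[t ft] : ~~ [forall t, word x (orbit_rep (s := vrot N) t) == 1%g].
  by apply/forallP.
by apply/esym/eqP/prodf_eq0; exists t => //; rewrite (negPf ft).
Qed.

(* The assignments that contribute to the state sum, precomposed with [dflip]: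
   the constraints on the edges then say that the assignment is constant on the
   faces, with a constant representation on each component. *)
Definition admissible (b : {ffun D -> I}) :=
  [forall d, (b (frot N d) == b d) && (tag (b (dflip N d)) == tag (b d))].

(** The left side lists the nonvanishing conditions of [irr_schur] at all edges. They make b agree
    at [dflip N d] and [vrot N d], which after precomposition with [dflip N] is invariance under
    [frot N]. *)
Lemma admissibleE (b : {ffun D -> I}) :
  [forall e, [&& tag (b (e, false)) == tag (b (vrot N (e, false))),
                 b (e, false) == b (vrot N (e, true)) &
                 b (vrot N (e, false)) == b (e, true)]] =
  admissible [ffun d => b (dflip N d)].
Proof.
have flipK := @dflipK N.
have flipE e c : dflip N (e, c) = (e, ~~ c) by rewrite permE.
apply/forallP/forallP => [H | H].
  have Hb d : b (dflip N d) = b (vrot N d).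
    case: d => e c; have /and3P[_ /eqP E1 /eqP E2] := H e.
    by case: c; rewrite flipE.
  have Ht d : tag (b d) = tag (b (vrot N d)).
    case: d => e [] /=; have /and3P[/eqP E0 /eqP E1 /eqP E2] := H e => //.
    by rewrite -E1 -E2 -E0.
  move=> d; rewrite !ffunE flipK /frot permM Hb permKV eqxx /=.
  by rewrite Hb -Ht.
have Hb d : b (dflip N d) = b (vrot N d).
  have /andP[/eqP + _] := H (dflip N (vrot N d)).
  by rewrite !ffunE /frot permM !flipK permK.
have Ht d : tag (b d) = tag (b (vrot N d)).
  have /andP[_ /eqP] := H d; rewrite !ffunE flipK => ->.
  by rewrite Hb.
move=> e; rewrite -!Hb !flipE !eqxx /= andbT.
by rewrite Ht -Hb flipE.
Qed.

(** Invariance of the tag under [vrot N] holds because [frot N] sends [dflip N (vrot N d)] to d. *)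
Lemma admissible_comp (b : {ffun D -> I}) d d' :
  admissible b -> comp_of d = comp_of d' -> tag (b d) = tag (b d').
Proof.
move=> /forallP adm_b eq_c.
apply: (comp_of_fun (u := fun d => tag (b d))) eq_c => {}d; last first.
  by have /andP[_ /eqP] := adm_b d.
have /andP[/eqP + _] := adm_b (dflip N (vrot N d)).
have /andP[_ /eqP] := adm_b (vrot N d) => <-.
by rewrite /frot permM dflipK permK => ->.
Qed.

Lemma sum_flows :
  #|[set x : {ffun edge N -> gT} | [forall e, x e \in G] && local_flow x]|%:R =
  \sum_(b : {ffun D -> I} | admissible b)
    (\prod_t Iirr_weight (tag (b (orbit_rep (s := vrot N) t)))) *
    \prod_e (Iirr_weight (tag (b (e, false))))^-1.
Proof.
have flip_bij : bijective (fun b : {ffun D -> I} => [ffun d => b (dflip N d)]).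
  apply: inv_bij => b; apply/ffunP=> d; rewrite !ffunE.
  by rewrite dflipK.
rewrite -sum1_card natr_sum (eq_bigl (fun x : {ffun edge N -> gT} =>
  (x \in ffun_on G) && local_flow x)) => [|x]; last first.
  by rewrite inE; congr (_ && _); apply/forallP/ffun_onP.
rewrite big_mkcondr /=.
transitivity (\sum_(x : {ffun edge N -> gT} | x \in ffun_on G)
  \sum_(b : {ffun D -> I})
    (\prod_t irr_weight (b (orbit_rep (s := vrot N) t))) *
    \prod_d irr_entry (dart_val x d) (b d) (b (vrot N d))).
  by apply: eq_bigr => x /ffun_onP Gx; rewrite -flow_indicator //; case: ifP.
(* The sum over x goes inside, and b is replaced by its precomposition with [dflip N]. *)
rewrite exchange_big /= (reindex _ (onW_bij _ flip_bij)) [RHS]big_mkcond /=.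
apply: eq_bigr => b _; rewrite -mulr_sumr.
set b' := finfun _; have b'K : [ffun d => b' (dflip N d)] = b.
  by apply/ffunP=> d; rewrite !ffunE; rewrite dflipK.
rewrite -{1}b'K -admissibleE.
(* For fixed states the sum over x factors over the edges: the value g occurs at the tail and g^-1
   at the head. *)
transitivity ((\prod_t irr_weight (b' (orbit_rep (s := vrot N) t))) * 
  \prod_e \sum_(g in G) irr_entry g (b' (e, false)) (b' (vrot N (e, false))) *
      irr_entry g^-1%g (b' (e, true)) (b' (vrot N (e, true)))).
  congr (_ * _); rewrite bigA_distr_big; apply: eq_bigr => x _.
  transitivity (\prod_e \prod_(c : bool)
      irr_entry (dart_val x (e, c)) (b' (e, c)) (b' (vrot N (e, c)))).
    by rewrite pair_bigA; apply: eq_bigr => -[].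
  by apply: eq_bigr => e _; rewrite big_bool mulrC.
under [X in _ * X]eq_bigr do rewrite irr_schur.
case: ifP => [/forallP H | /negbT/forallPn[e He]]; last first.
  by rewrite (bigD1 e) //= (negPf He) mul0r mul0r mulr0.
have adm_b : admissible b by rewrite -b'K -admissibleE; apply/forallP.
congr (_ * _); apply: eq_bigr => t _.
  by rewrite /irr_weight ffunE; have /andP[_ /eqP->] := forallP adm_b (orbit_rep t).
rewrite H mul1r /irr_weight ffunE.
by have /andP[_ /eqP->] := forallP adm_b (t, false).
Qed.

(** Admissible states are grouped by their labelling L of components by representations. Given L,
    what remains free is one matrix index per face. *)
Lemma sum_flows_comp :
  #|[set x : {ffun edge N -> gT} | [forall e, x e \in G] && local_flow x]|%:R =
  \prod_(c : comp_type N) \sum_(i : Iirr G)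
    Iirr_weight i ^+ comp_vert (inl c) * Iirr_weight i ^- comp_edge (inl c) *
    (irr_dim i)%:R ^+ comp_face (inl c).
Proof.
rewrite sum_flows bigA_distr_bigA /=.
rewrite (partition_big (fun b : {ffun D -> I} =>
  [ffun c => tag (b (comp_rep c))]) predT) //=.
apply: eq_bigr => L _.
(* Compatibility with L becomes a 0/1 factor per face, so that b ranges over all states constant on
   faces and the sum factors. *)
transitivity (\sum_(b : {ffun D -> I} |
    [forall d, b (orbit_rep (orbit_of (frot N) d)) == b d])
    \prod_(t : orbit_type (frot N))
       (L (comp_of (orbit_rep t)) == tag (b (orbit_rep t)))%:R *
   ((\prod_t Iirr_weight (L (comp_of (orbit_rep (s := vrot N) t)))) *
    \prod_e (Iirr_weight (L (comp_of (e, false))))^-1)).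
  rewrite [RHS](bigID (fun b : {ffun D -> I} =>
    [forall d, tag (b d) == L (comp_of d)])) /=.
  rewrite [X in _ = _ + X]big1 ?addr0; last first.
    move=> b /andP[/forallP b_frot /forallPn[d ne_bd]].
    apply/eqP; rewrite mulf_eq0; apply/orP; left; apply/prodf_eq0.
    exists (orbit_of (frot N) d) => //; rewrite (eqP (b_frot d)).
    have -> : comp_of (orbit_rep (orbit_of (frot N) d)) = comp_of d.
      apply: orbit_of_fun (orbit_repK _) => d'.
      by rewrite comp_of_gen ?frot_gen.
    by rewrite [L _ == _]eq_sym (negPf ne_bd).
  apply: eq_big => [b | b].
    apply/andP/andP => [[adm_b /eqP <-] | [/forallP b_frot /forallP b_L]]; split.
    - apply/forallP=> d; apply/eqP; apply: orbit_of_fun (orbit_repK _) => d'.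
      by have /andP[/eqP] := forallP adm_b d'.
    - apply/forallP=> d; rewrite ffunE; apply/eqP; apply: admissible_comp => //.
      by rewrite comp_repK.
    - apply/forallP=> d; rewrite (eqP (b_L _)) (eqP (b_L d)).
      rewrite (comp_of_gen _ (dflip_gen N)) eqxx andbT.
      by rewrite -(eqP (b_frot d)) -(eqP (b_frot (frot N d))) orbit_of_perm.
    by apply/eqP/ffunP=> c; rewrite ffunE (eqP (b_L _)) comp_repK.
  case/andP=> adm_b /eqP <-.
  have tagE d : tag (b (comp_rep (comp_of d))) = tag (b d).
    by apply: admissible_comp => //; rewrite comp_repK.
  rewrite [X in _ = X * _]big1 => [|t _]; last by rewrite ffunE tagE eqxx.
  rewrite mul1r; congr (_ * _); apply: eq_bigr => t _; by rewrite ffunE tagE.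
rewrite -mulr_suml (sum_fiberwise_constant (@orbit_repK _ (frot N))
   (fun t k => (L (comp_of (orbit_rep t)) == tag k)%:R)).
have -> : \prod_(t : orbit_type (frot N)) \sum_(k : I)
     (L (comp_of (orbit_rep t)) == tag k)%:R =
   \prod_(t : orbit_type (frot N)) (irr_dim (L (comp_of (orbit_rep t))))%:R :> algC.
  apply: eq_bigr => t _; set i := L _; rewrite sum_irr_index (bigD1 i) //=.
  rewrite [X in _ + X]big1 ?addr0 => [|j ne_j]; last first.
    by rewrite big1 // => a _; rewrite eq_sym (negPf ne_j).
  by rewrite eqxx sumr_const card_ord.
(* Used for faces, vertices and edges in turn. *)
have regroup (X : finType) (f : X -> comp_type N) (u : Iirr G -> algC) :
    \prod_t u (L (f t)) = \prod_c u (L c) ^+ #|[pred t | f t == c]|.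
  rewrite (partition_big f predT) //=; apply: eq_bigr => c _.
  by rewrite (eq_bigr (fun=> u (L c))) ?prodr_const // => t /eqP->.
rewrite (regroup _ (fun t : orbit_type (frot N) => comp_of (orbit_rep t))
  (fun i => (irr_dim i)%:R)).
rewrite (regroup _ (fun t : orbit_type (vrot N) => comp_of (orbit_rep t))
  (@Iirr_weight gT G)).
rewrite (regroup _ (fun e => comp_of (e, false)) (fun i => (Iirr_weight i)^-1)).
rewrite -!big_split /=; apply: eq_bigr => c _.
rewrite -card_comp_edges -!card_comp_orbits ?vrot_gen ?frot_gen // exprVn.
by rewrite mulrC.
Qed.

Lemma all_flow_count :
  #|[set x : {ffun edge N -> gT} | [forall e, x e \in G] && local_flow x]|%:R =
  (#|G|%:R : algC) ^ nullity N * \prod_(c : component N) comp_factor G c.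
Proof.
have nzG : #|G|%:R != 0 :> algC by rewrite pnatr_eq0 -lt0n cardG_gt0.
have nzd (i : Iirr G) : (irr_dim i)%:R != 0 :> algC.
  by rewrite pnatr_eq0 -lt0n irr_degree_gt0.
(* The factor of an isolated vertex is 1, since the squares of the dimensions sum to |G|. *)
rewrite sum_flows_comp big_sumType /= [X in _ * (_ * X)]big1 => [|v _]; last first.
  rewrite /comp_factor chi_inr; apply: (mulfI nzG).
  rewrite mulr1 mulrA divff // mul1r -irr_sum_square.
  by apply: eq_bigr => i _; rewrite irr1_degree.
rewrite mulr1.
(* An isolated vertex adds one vertex and one component, which cancel. *)
have -> : nullity N = \sum_(c : comp_type N)
   ((comp_edge (inl c))%:Z - (comp_vert (inl c))%:Z + 1).
  rewrite /nullity /nb_edge /nb_vert /nb_comp card_sum.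
  rewrite big_split sumrB /= sumr_const !PoszD.
  rewrite -!(big_morph _ PoszD (erefl (Posz 0))).
  have -> : (\sum_(c : comp_type N) comp_edge (inl c))%N = #|edge N|.
    rewrite -sum1_card (partition_big (fun e => comp_of (e, false)) predT) //.
    by apply: eq_bigr => c _; rewrite card_comp_edges sum1_card.
  have -> : (\sum_(c : comp_type N) comp_vert (inl c))%N = #|porbits (vrot N)|.
    transitivity #|orbit_type (vrot N)|; last by rewrite card_sig.
    rewrite -sum1_card (partition_big (fun t => comp_of (orbit_rep t)) predT) //.
    apply: eq_bigr => c _.
    by rewrite [LHS](card_comp_orbits c (vrot_gen N)) sum1_card.
  by rewrite natz opprD [_ + (_ - _)]addrA addrACA addNr addr0.
have expr_sum (T : finType) (h : T -> int) :
    #|G|%:R ^ (\sum_t h t) = \prod_t #|G|%:R ^ h t :> algC.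
  by apply: (big_morph (fun z : int => #|G|%:R ^ z)) => // y z; rewrite expfzDr.
rewrite expr_sum -big_split /=; apply: eq_bigr => c _.
rewrite /comp_factor chi_inl mulrA mulr_sumr; apply: eq_bigr => i _.
by rewrite -[RHS]mulrA; apply: euler_monomial.
Qed.

End FlowSum.

(** * Deletion *)

Section DeletionFlows.

Variables (gT : finGroupType) (M : cmap) (B : {set edge M}).

Local Notation N := (delete_edges B).
Local Notation kept := (@to_kept M B).

Definition flow_ext (y : {ffun edge N -> gT}) : {ffun edge M -> gT} :=
  [ffun e => if insub e is Some e' then y e' else 1%g].

Lemma dart_val_ext y (d : dart M) :
  dart_val (flow_ext y) d =
  (if kept d is Some d' then dart_val (M := N) y d' else 1%g).
Proof.
case: d => e b; rewrite /dart_val /to_kept /= ffunE.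
by case: insubP => [u _ _ | _] //=; rewrite invg1 if_same.
Qed.

Lemma prod_dart_val_ext y (p : seq (dart M)) :
  (\prod_(d <- p) dart_val (flow_ext y) d =
   \prod_(d <- pmap kept p) dart_val (M := N) y d)%g.
Proof.
elim: p => [|d p IHp]; first by rewrite !big_nil.
rewrite big_cons dart_val_ext IHp /=.
by case: (kept d) => [d'|] /=; rewrite ?mul1g // big_cons.
Qed.

Lemma next_kept_first (d d' : kept_edge B * bool) n :
    kept (iter n.+1 (vrot M) (kept_dart d)) = Some d' ->
    (forall m, (m < n)%N -> kept (iter m.+1 (vrot M) (kept_dart d)) = None) ->
  next_kept d = d'.
Proof.
have [n0 E0 none0] := next_keptE d => E none.
have := congr1 kept E0; rewrite kept_dartK => E0'.
case: (ltngtP n n0) => [/none0 | /none | eq_n]; rewrite ?E -?E0' //.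
by move: E; rewrite eq_n -E0' => -[].
Qed.

(** Induction invariant: d is the last kept dart passed, and n deleted darts have been met since. *)
Lemma fpath_kept (p : seq (dart M)) (d : kept_edge B * bool) n :
    fpath (vrot M) (iter n (vrot M) (kept_dart d)) p ->
    (forall m, (m < n)%N -> kept (iter m.+1 (vrot M) (kept_dart d)) = None) ->
  fpath (@next_kept M B) d (pmap kept p).
Proof.
elim: p d n => [|z p IHp] d n //= /andP[/eqP <- path_p] none.
rewrite -iterS in path_p *; case Ez: (kept _) => [d'|] /=.
  rewrite (next_kept_first Ez none) eqxx /=; apply: (IHp d' 0%N) => //=.
  by have := to_keptK B (iter n.+1 (vrot M) (kept_dart d)); rewrite Ez /= => ->.
by apply: IHp path_p _ => m; rewrite ltnS leq_eqVlt => /orP[/eqP-> | /none].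
Qed.

(** Filtering the cycle in M leaves a duplicate-free cycle of N through d. Equality up to rotation
    suffices for words tested against 1. *)
Lemma orbit_kept (d : kept_edge B * bool) :
  exists i, fingraph.orbit (vrot N) d =
    rot i (pmap kept (fingraph.orbit (vrot M) (kept_dart d))).
Proof.
set p := pmap _ _.
have Up : uniq p by rewrite (pmap_uniq (@to_keptK M B)) ?orbit_uniq.
have p_d : d \in p.
  by rewrite mem_pmap -(@kept_dartK M B d) map_f // -fconnect_orbit.
have cyc_p : fcycle (vrot N) p.
  have := cycle_orbit (@perm_inj _ (vrot M)) (kept_dart d).
  rewrite /p /fingraph.orbit -orderSpred trajectS; set q := traject _ _ _ => /=.
  rewrite kept_dartK /= => cyc_q.
  have -> : rcons (pmap kept q) d = pmap kept (rcons q (kept_dart d)).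
    by rewrite -!cats1 pmap_cat /= kept_dartK.
  rewrite (eq_path (e' := frel (@next_kept M B))) => [|d1 d2].
    by apply: (@fpath_kept _ d 0%N).
  by rewrite /= permE.
by have [i ->] := orbit_rot_cycle cyc_p Up p_d; exists i.
Qed.

Lemma local_flow_ext y : local_flow (flow_ext y) = local_flow (M := N) y.
Proof.
have wordE (d : kept_edge B * bool) :
    ((\prod_(d' <- fingraph.orbit (vrot M) (kept_dart d))
        dart_val (flow_ext y) d')%g == 1%g) =
    ((\prod_(d' <- fingraph.orbit (vrot N) d)
        dart_val (M := N) y d')%g == 1%g).
  by have [i ->] := orbit_kept d; rewrite prod_rot_eq1 prod_dart_val_ext.
apply/forallP/forallP => [flow_y d | flow_y d]; first by rewrite -wordE.
(* A vertex that loses all its edges has only identity values, hence no condition in N. *)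
case: (boolP (has (fun d' => kept d') (fingraph.orbit (vrot M) d))) => [|no_kept].
  case/hasP=> d' d_d'; case Ed': (kept d') => [d0|] // _.
  have := to_keptK B d'; rewrite Ed' /= => Ed0.
  by rewrite -(prod_orbit_eq1 _ d_d') -Ed0 wordE.
rewrite prod_dart_val_ext.
suff -> : pmap kept (fingraph.orbit (vrot M) d) = [::] by rewrite big_nil.
by apply/eqP; rewrite -size_eq0 size_pmap -leqn0 leqNgt -has_count.
Qed.

Lemma flow_ext_inj : injective flow_ext.
Proof.
move=> y1 y2 /ffunP E; apply/ffunP=> e.
by have := E (val e); rewrite !ffunE valK.
Qed.

Lemma card_flows_trivial_on (G : {group gT}) :
  #|[set x : {ffun edge M -> gT} |
      [&& [forall e, x e \in G], local_flow x & [forall e in B, x e == 1%g]]]| =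
  #|[set y : {ffun edge N -> gT} |
      [forall e, y e \in G] && local_flow (M := N) y]|.
Proof.
rewrite -[RHS](card_imset _ flow_ext_inj); apply: eq_card => x; rewrite inE.
apply/and3P/imsetP => [[/forallP Gx flow_x /forallP x1] | [y]].
  exists [ffun e : edge N => x (val e)]; last first.
    apply/ffunP=> e; rewrite ffunE; case: insubP => [e' _ Ee' | ].
      by rewrite ffunE Ee'.
    by rewrite negbK => /(implyP (x1 e)) /eqP.
  rewrite inE -local_flow_ext; apply/andP; split.
    by apply/forallP=> e; rewrite ffunE.
  rewrite (_ : flow_ext _ = x) //; apply/ffunP=> e; rewrite ffunE.
  case: insubP => [e' _ Ee' | ]; first by rewrite ffunE Ee'.
  by rewrite negbK => /(implyP (x1 e)) /eqP.
rewrite inE => /andP[/forallP Gy flow_y] ->; rewrite local_flow_ext; split=> //.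
  by apply/forallP=> e; rewrite ffunE; case: insubP.
apply/forallP=> e; apply/implyP=> Be; rewrite ffunE insubF //.
by rewrite Be.
Qed.

End DeletionFlows.

(** * Inclusion-exclusion over the edges with identity value *)

Section InclusionExclusion.

Variables (gT : finGroupType) (G : {group gT}) (M : cmap).

Lemma flow_count_formula :
  (flow_count G M)%:R =
    \sum_(A : {set edge M})
      (-1) ^+ #|~: A| * (#|G|%:R : algC) ^ nullity (delete_edges (~: A)) *
      \prod_(c : component (delete_edges (~: A))) comp_factor G c.
Proof.
(* B is the deleted set; its term counts, up to sign, the flows of M trivial on B. *)
rewrite [RHS](reindex_inj (@setC_inj _)) /=.
under eq_bigr => B _.
  rewrite setCK -mulrA -all_flow_count -card_flows_trivial_on; over.
pose P (x : {ffun edge M -> gT}) := [forall e, x e \in G] && local_flow x.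
(* The product is the indicator of being nowhere the identity; expanding it gives the sum over B. *)
transitivity (\sum_(x | P x) \prod_(e : edge M) (- (x e == 1%g)%:R + 1) : algC).
  rewrite /flow_count -sum1_card natr_sum.
  rewrite (eq_bigl (fun x => P x && [forall e, x e != 1%g])).
    rewrite big_mkcondr; apply: eq_bigr => x _; case: ifP => [/forallP x1|/negbT].
      by rewrite big1 // => e _; rewrite (negPf (x1 e)) oppr0 add0r.
    case/forallPn=> e; rewrite negbK => xe1.
    apply/esym/eqP/prodf_eq0; exists e => //; by rewrite xe1 addNr.
  move=> x; rewrite inE /P /nowhere_id.
  have -> : [forall e, (x e \in G) && (x e != 1%g)] =
      [forall e, x e \in G] && [forall e, x e != 1%g].
    apply/forallP/andP=> [H | [/forallP H1 /forallP H2] e]; last by rewrite H1 H2.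
    by split; apply/forallP=> e; case/andP: (H e).
  by rewrite andbAC.
rewrite (eq_bigr (fun x : {ffun edge M -> gT} =>
  \sum_(B in {set edge M}) \prod_(e : edge M)
    (if e \in B then - (x e == 1%g)%:R else 1))) => [|x _]; last exact: bigA_distr.
rewrite exchange_big /=; apply: eq_bigr => B _.
rewrite -[X in _ = _ * X%:R]sum1_card natr_sum mulr_sumr.
rewrite [RHS](eq_bigl (fun x => P x && [forall e in B, x e == 1%g])) => [|x].
  rewrite [RHS]big_mkcondr /=; apply: eq_bigr => x _; rewrite -big_mkcond /=.
  case: ifP => [/forallP x1 | /negbT].
    rewrite mulr1 -prodr_const; apply: eq_bigr => e Be.
    by rewrite (implyP (x1 e)).
  case/forallPn=> e; rewrite negb_imply => /andP[Be xe1].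
  by apply/eqP/prodf_eq0; exists e => //; rewrite (negPf xe1) oppr0.
by rewrite inE andbA.
Qed.

End InclusionExclusion.

(** * Duality *)

Section Duality.

Variable N : cmap.

Lemma dflip_dual : dflip (dual_map N) = dflip N.
Proof. by apply/permP=> d; rewrite !permE. Qed.

(** The faces of the dual are thus the vertices of N with all darts reversed. *)
Lemma frot_dual : frot (dual_map N) = ((vrot N) ^ (dflip N)^-1)%g.
Proof. by rewrite {1}/frot dflip_dual /= /frot invMg invgK conjgE invgK. Qed.

(** Each of [vrot N] and [frot N] is expressed through the other and [dflip N], so the generated
    groups agree. *)
Lemma dart_comps_dual : dart_comps (dual_map N) = dart_comps N.
Proof.
rewrite /dart_comps.
suff -> : <<[set vrot (dual_map N); dflip (dual_map N)]>>%g =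
  <<[set vrot N; dflip N]>>%g by [].
rewrite dflip_dual; apply/eqP; rewrite eqEsubset !gen_subG !subUset !sub1set.
have sf : dflip N \in <<[set frot N; dflip N]>>%g.
  by rewrite mem_gen // !inE eqxx orbT.
have sr : frot N \in <<[set frot N; dflip N]>>%g by rewrite mem_gen // !inE eqxx.
rewrite (frot_gen N) (dflip_gen N) sf andbT /=.
have -> : vrot N = ((frot N)^-1 * dflip N)%g by rewrite /frot invMg invgK mulgKV.
by rewrite groupM ?groupV.
Qed.

Lemma card_porbits_conj (D : finType) (s t : {perm D}) (o : {set D}) :
    t \in ('N(o | 'P))%g ->
  #|[set p in porbits (s ^ t)%g | p \subset o]| =
  #|[set p in porbits s | p \subset o]|.
Proof.
move=> t_o; have porbitJ d :
    porbit (s ^ t)%g (t d) = [set t d' | d' in porbit s d].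
  apply/setP=> z; apply/porbitP/imsetP => [[i ->]|[d' /porbitP[i ->] ->]].
    exists ((s ^+ i)%g d); first exact: mem_porbit.
    by rewrite -conjXg conjgE !permM permK.
  by exists i; rewrite -conjXg conjgE !permM permK.
have sub_o (p : {set D}) : ([set t d | d in p] \subset o) = (p \subset o).
  apply/subsetP/subsetP => sub_p d => [p_d | /imsetP[d' p_d' ->]].
    by have := astabs_act d t_o; rewrite /= apermE sub_p ?imset_f.
  by have := astabs_act d' t_o; rewrite /= apermE => ->; apply: sub_p.
rewrite -[RHS](card_imset _ (imset_inj (@perm_inj _ t))).
apply: eq_card => p; rewrite inE; apply/andP/imsetP => [[] | [q]].
  case/imsetP=> d _ ->; rewrite -[d](permKV t) porbitJ sub_o => sub_d.
  by exists (porbit s (t^-1%g d)) => //; rewrite inE imset_f.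
rewrite inE => /andP[/imsetP[d _ ->] sub_d] ->.
by rewrite sub_o -porbitJ imset_f.
Qed.

(** Duality exchanges vertices and faces in each component, which leaves the Euler characteristic
    unchanged. *)
Lemma prod_comp_factor_dual (gT : finGroupType) (G : {group gT}) :
  \prod_(c : component (dual_map N)) comp_factor G c =
  \prod_(c : component N) comp_factor G c.
Proof.
rewrite !big_sumType /=; congr (_ * _).
(* Stated for arbitrary dart sets, so that the index set of the product can be rewritten by
   [dart_comps_dual]. *)
pose h (o : {set dart N}) : int :=
  #|[set p in porbits (vrot N) | p \subset o]|%:Z -
  #|[set e : edge N | ((e, false) : dart N) \in o]|%:Z +
  #|[set p in porbits (frot N) | p \subset o]|%:Z.
pose F (o : {set dart N}) : algC :=
  #|G|%:R^-1 * \sum_(i : Iirr G) (irr_dim i)%:R ^ h o.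
transitivity
  (\prod_(c : {o : {set dart N} | o \in dart_comps (dual_map N)}) F (val c)).
  apply: eq_bigr => c _; congr (_ * _); apply: eq_bigr => i _; congr (_ ^ _).
  rewrite chi_inl /= frot_dual card_porbits_conj; last first.
    by rewrite groupV -dflip_dual (gen_stable (N := dual_map N)) ?dflip_gen.
  by rewrite /h addrAC [_ + _ - _]addrAC addrC addrA addrAC.
rewrite dart_comps_dual; apply: eq_bigr => c _.
by congr (_ * _); apply: eq_bigr => i _; rewrite chi_inl.
Qed.

Lemma dual_nullity_dual : dual_nullity (dual_map N) = nullity N.
Proof.
rewrite /dual_nullity /nullity /nb_edge /nb_face /nb_vert /nb_comp /=.
congr (_ - (_ + _)%N%:Z + _%:Z).
  have allT (s : {perm dart N}) :
      porbits s = [set p in porbits s | p \subset setT].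
    by apply/setP=> p; rewrite inE subsetT andbT.
  rewrite frot_dual allT card_porbits_conj -?allT //.
  by rewrite !inE; apply/subsetP=> d; rewrite !inE.
by rewrite !card_sum !card_sig; rewrite dart_comps_dual.
Qed.

End Duality.

Theorem theorem5p7 (gT : finGroupType) (G : {group gT}) (M : cmap) :
  (flow_count G M)%:R =
    \sum_(A : {set edge M})
      (-1) ^+ #|~: A| * (#|G|%:R : algC) ^ nullity (delete_edges (~: A)) *
      \prod_(c : component (delete_edges (~: A))) comp_factor G c
  /\
  (tension_count G M)%:R =
    \sum_(A : {set edge M})
      (-1) ^+ #|A| * (#|G|%:R : algC) ^ dual_nullity (contract_edges A) *
      \prod_(c : component (contract_edges A)) comp_factor G c.
Proof.
split; first exact: flow_count_formula.
(* Faces of M are, by definition, the vertices of its dual. *)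
have -> : tension_count G M = flow_count G (dual_map M) by [].
rewrite flow_count_formula (reindex_inj (@setC_inj _)) /=; apply: eq_bigr => A _.
by rewrite setCK /contract_edges dual_nullity_dual prod_comp_factor_dual.
Qed.
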